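(* Suppose $\mathbb{R}^n$ and $\mathbb{R}^m$ are endowed with (arbitrary) norms, both denoted $\|\cdot\|$. Let $A\in\mathbb{R}^{m\times n}$, $c\in\mathbb{R}^n$, let $g:\mathbb{R}^m\to\mathbb{R}\cup\{\infty\}$ be convex, differentiable and $\mu_g$-strongly convex for the norm in $\mathbb{R}^m$, and let $f:\mathbb{R}^n\to\mathbb{R}\cup\{\infty\}$ be defined via $f(x)=g(Ax)+\langle c,x\rangle$. Let $X\subseteq\mathbb{R}^n$ be a polyhedron with $X\subseteq\mathrm{dom}(f)$ such that $A(X)$ contains more than one point, and let $D:X\times X\to\mathbb{R}_+$ be a distance-like function with $D(x,y)\le\frac12\|x-y\|^2$ for all $x,y\in X$. Assume that $f^\star:=\min_{x\in X}f(x)$ is finite, that $X^\star:=\{x\in X:f(x)=f^\star\}\ne\emptyset$, and that the map $x\mapsto\bar x:=\mathrm{argmin}_{y\in X^\star}D(y,x)$ is well defined for all $x\in X$. Then the vector $v:=2\nabla f(y)$ is the same for all $y\in X^\star$ and satisfies $\langle v,x-y\rangle\ge0$ for all $x\in X$, $y\in X^\star$. Furthermore, one of the following two cases applies. Case 1: For all $x\in X$, $y\in X^\star$ we have $\langle v,x-y\rangle=0$. In this case \[ \mu^\sharp_{f,X,D}\ \ge\ \inf_{C\in\mathcal{T}(A|X,X^\star)}\frac{\mu_g}{\|(A|C)^{-1}\|^2}. \] Case 2: For some $x\in X$, $y\in X^\star$ we have $\langle v,x-y\rangle>0$. In this case, for all $\delta>0$, \[ \mu^\sharp_{f,X_\delta,D}\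 \ge\ \inf_{C\in\mathcal{T}(M|X_\delta,X^\star)}\frac{1}{\|(M|C)^{-1}\|^2}, \] for the polyhedron $X_\delta:=\{x\in X:\langle v,x-y\rangle\le\delta\text{ for all }y\in X^\star\}\supseteq X^\star$, the matrix $M\in\mathbb{R}^{(m+1)\times n}$ and the norm $\|\cdot\|$ in $\mathbb{R}^{m+1}$ defined by \[ M:=\begin{bmatrix}\sqrt{\mu_g}\cdot A \\ \frac{1}{\sqrt{\delta}}\cdot v^{\mathsf T}\end{bmatrix},\qquad \left\|\begin{bmatrix} y \\ y_{m+1} \end{bmatrix}\right\|:=\sqrt{\|y\|^2+y_{m+1}^2}. \]
   Context: Distance-like: $D(y,x)\ge 0$ and $D(x,x)=0$ for all $x,y\in X$. The point $\bar x$ is a minimizer of $D(\cdot,x)$ over $X^\star$ (a fixed choice of one if it is not unique). The relative functional growth constant is \[ \mu^\sharp_{f,X,D}:=\sup\{\mu\ge0:\ f(x)-f^\star\ge\mu\,D(\bar x,x)\text{ for all }x\in X\}. \] $\mu^\sharp_{f,X_\delta,D}$ is the same quantity with $X_\delta$ in place of $X$ and $D$ restricted to $X_\delta\times X_\delta$ (the set of minimizers of $f$ over $X_\delta$ is again $X^\star$). $g$ is $\mu_g$-strongly convex for $\|\cdot\|$ (with $\mu_g>0$) if $D_g(w,u)\ge\frac{\mu_g}{2}\|w-u\|^2$ for all $u,w\in\mathrm{dom}(g)$, where $D_g(w,u)=g(w)-g(u)-\langle\nabla g(u),w-u\rangle$. For a matrix $B$ with $n$ columns and a convex cone $C\subseteq\mathbb{R}^n$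 (not necessarily containing $0$), \[ \|(B|C)^{-1}\|:=\sup_{w\in B(C),\,\|w\|\le1}\ \inf_{x\in C,\,Bx=w}\|x\|, \] with the convention $1/0=+\infty$. For a polyhedron $Y\subseteq\mathbb{R}^n$ and nonempty $S\subseteq Y$, $\mathcal{T}(B|Y,S):=\{T_Y(x;B,S):x\in Y\}$ where \[ T_Y(x;B,S):=\{d\in\mathbb{R}^n:\ x+td\in Y\text{ and }B(x+td)\in\mathrm{conv}(B(S))\text{ for some }t>0\}. \] *)

(* Defs.v *)
From mathcomp Require Export all_boot all_order all_algebra.
From mathcomp Require Export all_classical all_reals all_analysis.
Export Order.TTheory GRing.Theory Num.Theory.
Export numFieldNormedType.Exports.

Set Implicit Arguments.
Unset Strict Implicit.
Unset Printing Implicit Defensive.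

Local Open Scope classical_set_scope.
Local Open Scope ring_scope.

(* The canonical norm `|x| on 'cV[R]_n is the sup norm: it only provides the
   (norm-independent) topology and derivatives, while the arbitrary norms are
   functions 'cV[R]_n -> R satisfying is_norm. *)

Section Euclidean.
Variable R : realType.

Definition dot (n : nat) (u v : 'cV[R]_n) : R := (u^T *m v) 0 0.

Definition is_norm (n : nat) (N : 'cV[R]_n -> R) : Prop :=
  [/\ forall x y, N (x + y) <= N x + N y,
      forall (a : R) x, N (a *: x) = `|a| * N x
    & forall x, N x = 0 -> x = 0].

Definition sqrt_sum_norm (m : nat) (N : 'cV[R]_m -> R) (z : 'cV[R]_(m + 1)) : R :=
  Num.sqrt (N (usubmx z) ^+ 2 + (dsubmx z 0 0) ^+ 2).

Definition grad (n : nat) (h : 'cV[R]_n -> R) (x : 'cV[R]_n) : 'cV[R]_n :=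
  \col_i 'D_(delta_mx i 0) h x.

Definition polyhedron (n : nat) (Y : set 'cV[R]_n) : Prop :=
  exists (k : nat) (B : 'M[R]_(k, n)) (b : 'cV[R]_k),
    Y = [set x | forall i, (B *m x) i 0 <= b i 0].

End Euclidean.

Section ExtendedValued.
Variables (R : realType) (n : nat).
Implicit Types (h : 'cV[R]_n -> \bar R).

Definition dom h : set 'cV[R]_n := [set u | (h u < +oo)%E].

(* Together with the absence of the value -oo: functions into R u {+oo}. *)
Definition never_ninfty h : Prop := forall u, (-oo < h u)%E.

Definition convex_ext h : Prop :=
  forall (u w : 'cV[R]_n) (t : R), 0 < t -> t < 1 ->
    (h (t *: u + (1 - t) *: w)%R <= t%:E * h u + (1 - t)%:E * h w)%E.

(* Differentiable at every point of its domain. The first clause is needed since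
   [fine] sends +oo to 0; it says that u is interior to the domain, as is implicit
   in the differentiability at u of an extended-real-valued function. *)
Definition differentiable_ext h : Prop :=
  forall u, dom h u ->
    (\forall w \near u, h w \is a fin_num) /\ differentiable (fine \o h) u.

Definition bregman h (w u : 'cV[R]_n) : R :=
  fine (h w) - fine (h u) - dot (grad (fine \o h) u) (w - u).

Definition strongly_convex (N : 'cV[R]_n -> R) (mu : R) h : Prop :=
  0 < mu /\
  forall u w, dom h u -> dom h w -> mu / 2 * N (w - u) ^+ 2 <= bregman h w u.

Definition min_value h (X : set 'cV[R]_n) : \bar R := ereal_inf (h @` X).

Definition minimizers h (X : set 'cV[R]_n) : set 'cV[R]_n :=
  [set x | X x /\ h x = min_value h X].

End ExtendedValued.

Section RelativeGrowth.
Variables (R : realType) (n : nat).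
Implicit Types (f : 'cV[R]_n -> \bar R) (X S : set 'cV[R]_n).
Implicit Types (D : 'cV[R]_n -> 'cV[R]_n -> R).

(* D is only meaningful on X x X; its values elsewhere are irrelevant. *)
Definition distance_like X D : Prop :=
  forall x y, X x -> X y -> 0 <= D y x /\ D x x = 0.

Definition closest D S (x : 'cV[R]_n) : set 'cV[R]_n :=
  [set y | S y /\ forall z, S z -> D y x <= D z x].

(* x-bar: a fixed choice of an element of argmin_(y in X^star) D y x; the default
   value 0 is only used when no minimizer exists. *)
Definition bar f X D (x : 'cV[R]_n) : 'cV[R]_n :=
  xget 0 (closest D (minimizers f X) x).

Definition mu_sharp f X D : \bar R :=
  ereal_sup [set mu%:E | mu in [set mu : R | 0 <= mu /\
    forall x, X x ->
      ((mu * D (bar f X D x) x)%:E <= f x - min_value f X)%E]].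

End RelativeGrowth.

Section TangentCones.
Variables (R : realType) (n k : nat).
Implicit Types (B : 'M[R]_(k, n)) (C Y S : set 'cV[R]_n).

(* || (B|C)^-1 ||, with NX the norm on the domain and NY the one on the codomain.
   In \bar R one has 0^-1 = +oo and +oo^-1 = 0. *)
Definition inv_norm (NX : 'cV[R]_n -> R) (NY : 'cV[R]_k -> R) B C : \bar R :=
  ereal_sup [set ereal_inf [set (NX x)%:E | x in [set x | C x /\ B *m x = w]]
            | w in [set w | (mulmx B @` C) w /\ NY w <= 1]].

Definition conv (j : nat) (S : set 'cV[R]_j) : set 'cV[R]_j :=
  smallest (@convex_set R 'cV[R]_j) S.

Definition tangent_cone B Y S (x : 'cV[R]_n) : set 'cV[R]_n :=
  [set d | exists2 t : R, 0 < t &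
    Y (x + t *: d) /\ conv (mulmx B @` S) (B *m (x + t *: d))].

Definition tangent_cones B Y S : set (set 'cV[R]_n) :=
  [set tangent_cone B Y S x | x in Y].

End TangentCones.

(* Main.v *)
(* For x in X and y in X^star, strong convexity of g gives
     f x - f^star >= mu_g / 2 * |A (x - y)| ^ 2 + <v, x - y> / 2,
   where <v, x - y> >= 0 by optimality of y; applied to x in X^star, this shows
   that A, hence the gradient of f, is constant on X^star. In Case 1 the second
   term vanishes; in Case 2 it is at least <v, x - y> ^ 2 / (2 delta) on
   X_delta, so that the sum is at least |M (x - y)| ^ 2 / 2. In both cases
   X^star is the fiber through y of the matrix B (= A or M), and
   conv (B X^star) is a single point. Hence the tangent cone C at x consists of
   positive multiples of z - x with z in X^star, so that
     dist (x, X^star) <= |(B|C)^-1| * |B (x - y)|,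
   while D (bar x) x <= dist (x, X^star) ^ 2 / 2. *)
Require Import Defs.
From mathcomp Require Import ring lra.

Set Implicit Arguments.
Unset Strict Implicit.
Unset Printing Implicit Defensive.

Local Open Scope classical_set_scope.
Local Open Scope ring_scope.

(** * The pairing on column vectors *)

Section Dot.
Variables (R : realType) (n : nat).
Implicit Types u v w : 'cV[R]_n.

Lemma dotE u v : dot u v = \sum_i u i 0 * v i 0.
Proof. by rewrite /dot mxE; apply: eq_bigr => i _; rewrite mxE. Qed.

Lemma dotDl u v w : dot (u + v) w = dot u w + dot v w.
Proof. by rewrite /dot linearD mulmxDl mxE. Qed.

Lemma dotDr u v w : dot w (u + v) = dot w u + dot w v.
Proof. by rewrite /dot mulmxDr mxE. Qed.

Lemma dotZl a u v : dot (a *: u) v = a * dot u v.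
Proof. by rewrite /dot linearZ /= -scalemxAl mxE. Qed.

Lemma dotZr a u v : dot u (a *: v) = a * dot u v.
Proof. by rewrite /dot -scalemxAr mxE. Qed.

Lemma dotBr u v w : dot w (u - v) = dot w u - dot w v.
Proof. by rewrite -scaleN1r dotDr dotZr mulN1r. Qed.

Lemma dot_delta u i : dot u (delta_mx i 0) = u i 0.
Proof.
rewrite dotE (bigD1 i) //= big1 => [|j ji]; rewrite mxE ?(negbTE ji) ?mulr0 //.
by rewrite !eqxx mulr1 addr0.
Qed.

Lemma dot_mulmx m (A : 'M[R]_(m, n)) (q : 'cV[R]_m) u :
  dot q (A *m u) = dot (A^T *m q) u.
Proof. by rewrite /dot trmx_mul trmxK mulmxA. Qed.

End Dot.

(** * Consequences of the norm axioms *)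

Section Norm.
Variables (R : realType) (n : nat) (N : 'cV[R]_n -> R).
Hypothesis hN : is_norm N.

Lemma is_norm0 : N 0 = 0.
Proof.
by have [_ + _] := hN; rewrite -[in LHS](scale0r 0) => ->; rewrite normr0 mul0r.
Qed.

Lemma is_normN x : N (- x) = N x.
Proof. by have [_ + _] := hN; rewrite -scaleN1r => ->; rewrite normrN1 mul1r. Qed.

Lemma is_norm_ge0 x : 0 <= N x.
Proof.
have [tri _ _] := hN; have := tri x (- x).
by rewrite subrr is_norm0 is_normN; lra.
Qed.

End Norm.

(** * Homogeneity and definiteness of the combined norm *)

Section SqrtSumNorm.
Variables (R : realType) (m : nat) (N : 'cV[R]_m -> R).
Hypothesis hN : is_norm N.

Lemma sqrt_sum_normZ (a : R) z :
  sqrt_sum_norm N (a *: z) = `|a| * sqrt_sum_norm N z.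
Proof.
have [_ homN _] := hN.
rewrite /sqrt_sum_norm !linearZ /= homN mxE !exprMn real_normK ?num_real //.
by rewrite -mulrDr sqrtrM ?sqr_ge0 // sqrtr_sqr.
Qed.

Lemma sqrt_sum_norm_eq0 z : sqrt_sum_norm N z = 0 -> z = 0.
Proof.
have [_ _ defN] := hN.
move/eqP; rewrite sqrtr_eq0 => le0.
have uz : N (usubmx z) = 0.
  by apply/eqP; rewrite -sqrf_eq0; apply/eqP; move: le0 (sqr_ge0 (N (usubmx z)))
    (sqr_ge0 (dsubmx z 0 0)); lra.
have dz : dsubmx z 0 0 = 0.
  by apply/eqP; rewrite -sqrf_eq0; apply/eqP; move: le0 (sqr_ge0 (N (usubmx z)))
    (sqr_ge0 (dsubmx z 0 0)); lra.
rewrite -[z]vsubmxK (defN _ uz).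
suff -> : dsubmx z = 0 by rewrite col_mx0.
by apply/matrixP => i j; rewrite !ord1 dz mxE.
Qed.

Lemma sqrt_sum_norm_sqr z :
  sqrt_sum_norm N z ^+ 2 = N (usubmx z) ^+ 2 + dsubmx z 0 0 ^+ 2.
Proof. by rewrite sqr_sqrtr // addr_ge0 ?sqr_ge0. Qed.

End SqrtSumNorm.

(** * Directional derivatives and first-order optimality *)

Section Derivatives.
Variable R : realType.

Lemma dot_grad n (h : 'cV[R]_n -> R) x u :
  differentiable h x -> dot (grad h x) u = 'd h x u.
Proof.
move=> hx; rewrite [in RHS](matrix_sum_delta u) linear_sum dotE.
apply: eq_bigr => i _; rewrite big_ord1 linearZ /= mxE deriveE // mulrC.
by congr (_ * _).
Qed.

(** The difference quotients with [0 < t <= 1] are nonnegative, and the two-sided limit restricts to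
    [0^'+]. This is the optimality condition at a minimizer over a convex set, where only one side
    of the line is available. *)
Lemma derive_ge0_min (V : normedModType R) (phi : V -> R) (y u : V) :
  derivable phi y u ->
  (forall t : R, 0 < t -> t <= 1 -> phi y <= phi (y + t *: u)) ->
  0 <= 'D_u phi y.
Proof.
move=> hd hmin.
have hr : h^-1 *: ((phi \o shift y) (h *: u) - phi y) @[h --> (0:R)^'+] --> 'D_u phi y.
  apply: cvg_trans hd; apply: cvg_app.
  move=> A [e e0 Ae]; exists e => // x xe xgt0; apply: Ae => //.
  exact/lt0r_neq0.
rewrite -(cvg_lim _ hr) //; apply: limr_ge; first exact: cvgP hr.
near=> t; apply: mulr_ge0.
  by rewrite invr_ge0; apply: ltW; near: t; exists 1 => /=.
rewrite subr_ge0 /= addrC; apply: hmin; near: t; first by exists 1 => /=.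
exists 1 => //= t; rewrite /ball_ /= sub0r normrN => t1 _.
by rewrite ltW // (le_lt_trans (ler_norm _)).
Unshelve. all: by end_near. Qed.

(** The quotient of [f] at [y] along [u] is that of [g] at [A *m y] along [A *m u] plus the constant
    [dot c u], once [h] is so small that [g] is finite at the shifted point: there [fine] commutes
    with the sum. *)
Lemma is_derive_affine_comp n m (A : 'M[R]_(m, n)) (c : 'cV[R]_n)
    (g : 'cV[R]_m -> \bar R) (f : 'cV[R]_n -> \bar R) (y u : 'cV[R]_n) :
  (forall x, f x = (g (A *m x) + (dot c x)%:E)%E) ->
  (\forall w \near A *m y, g w \is a fin_num) ->
  differentiable (fine \o g) (A *m y) ->
  is_derive y u (fine \o f) (dot (A^T *m grad (fine \o g) (A *m y) + c) u).
Proof.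
move=> f_def gfin gdiff.
pose q (h : R) : R :=
  h^-1 *: (((fine \o g) \o shift (A *m y)) (h *: (A *m u)) - (fine \o g) (A *m y)).
have qcvg : q h + dot c u @[h --> 0^'] -->
    dot (A^T *m grad (fine \o g) (A *m y) + c) u.
  rewrite dotDl -dot_mulmx dot_grad // -deriveE //.
  apply: cvgD; last exact: cvg_cst.
  exact: (@diff_derivable _ _ _ (fine \o g) (A *m y) (A *m u) gdiff).
have lcvg : h *: (A *m u) + A *m y @[h --> (0:R)^'] --> A *m y.
  have zc : h @[h --> (0 : R)^'] --> (0 : R) by exact: cvg_within.
  have := cvgD (cvgZr_tmp (a := A *m u) zc) (cvg_cst (A *m y)).
  rewrite scale0r add0r; exact.
have fcvg : h^-1 *: (((fine \o f) \o shift y) (h *: u) - (fine \o f) y) @[h --> 0^'] -->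
    dot (A^T *m grad (fine \o g) (A *m y) + c) u.
  apply: cvg_trans qcvg; apply: near_eq_cvg.
  near=> h.
  have h0 : h != 0 by near: h; exact: nbhs_dnbhs_neq.
  have gh : g (h *: (A *m u) + A *m y) \is a fin_num by near: h; exact: (lcvg _ gfin).
  have gy : g (A *m y) \is a fin_num by exact: nbhs_singleton gfin.
  rewrite /q /= !f_def mulmxDr -scalemxAr !fineD //= dotDr dotZr /GRing.scale /=.
  by field.
split; first by apply/cvg_ex; eexists; exact: fcvg.
exact: cvg_lim fcvg.
Unshelve. all: by end_near. Qed.

Lemma grad_affine_comp n m (A : 'M[R]_(m, n)) (c : 'cV[R]_n)
    (g : 'cV[R]_m -> \bar R) (f : 'cV[R]_n -> \bar R) (y : 'cV[R]_n) :
  (forall x, f x = (g (A *m x) + (dot c x)%:E)%E) ->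
  (\forall w \near A *m y, g w \is a fin_num) ->
  differentiable (fine \o g) (A *m y) ->
  grad (fine \o f) y = A^T *m grad (fine \o g) (A *m y) + c.
Proof.
move=> f_def gfin gdiff; apply/colP => i; rewrite mxE.
have [_ ->] := is_derive_affine_comp (delta_mx i 0) f_def gfin gdiff.
exact: dot_delta.
Qed.

End Derivatives.

(** * From tangent cones to the growth constant *)

Section Growth.
Variables (R : realType) (n k : nat).
Variables (NX : 'cV[R]_n -> R) (NY : 'cV[R]_k -> R).
Hypothesis hNX : is_norm NX.
Hypothesis NY_homog : forall (a : R) z, NY (a *: z) = `|a| * NY z.
Hypothesis NY_ge0 : forall z, 0 <= NY z.
Hypothesis NY_eq0 : forall z, NY z = 0 -> z = 0.

Lemma conv_image_const (B : 'M[R]_(k, n)) (S : set 'cV[R]_n) w0 :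
  (forall y, S y -> B *m y = w0) -> conv (mulmx B @` S) `<=` [set w0].
Proof.
move=> Sw0; apply: smallest_sub => [|_ [y /Sw0 <-] <-//].
move=> u w l /set_mem -> /set_mem ->; apply/mem_set => /=.
by rewrite convmm.
Qed.

(* On the tangent cone at x every direction d is mapped to a multiple of
   w0 - B x, and B d = w0 - B x forces x + d to lie in S. *)
Lemma ge_inv_norm (B : 'M[R]_(k, n)) (Y S : set 'cV[R]_n) w0 x s :
  S !=set0 -> S `<=` Y -> (forall y, S y -> B *m y = w0) ->
  (forall y, Y y -> B *m y = w0 -> S y) ->
  B *m x <> w0 -> (forall y, S y -> s <= NX (y - x)) ->
  ((s / NY (w0 - B *m x))%:E <= inv_norm NX NY B (tangent_cone B Y S x))%E.
Proof.
have [_ NX_homog _] := hNX.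
move=> [y0 Sy0] SY Sw0 w0S Bx sNX; set e := w0 - B *m x.
have e_neq0 : e != 0 by rewrite subr_eq0; apply/eqP => /esym.
have Ne_gt0 : 0 < NY e.
  by rewrite lt_def NY_ge0 andbT; apply: contra_neq e_neq0 => /NY_eq0.
(* The supremum is tested at the unit vector [(NY e)^-1 *: e], the image of the tangent direction
   [(NY e)^-1 *: (y0 - x)]. *)
apply: le_ereal_sup_tmp; eexists.
  exists ((NY e)^-1 *: e); last reflexivity.
  split; last by rewrite NY_homog gtr0_norm ?invr_gt0 // mulVf ?gt_eqF.
  exists ((NY e)^-1 *: (y0 - x)); last by rewrite -scalemxAr mulmxBr Sw0.
  exists (NY e) => //; rewrite scalerA divff ?gt_eqF // scale1r subrKC.
  split; first exact: SY.
  by apply: sub_gen_smallest; exists y0.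
apply: le_ereal_inf_tmp => _ [d [[t t_gt0 [Yt /(conv_image_const Sw0) Bt]] Bd] <-].
(* Since [B *m (x + t *: d) = w0], the vector [t *: (B *m d)] is [e]; as [e] is nonzero, this fixes
   [t]. Hence [NY e * NX d] is the distance from [x] to a point of [S]. *)
have tN : t = NY e.
  have te : (t / NY e) *: e = e.
    apply: (addrI (B *m x)).
    by rewrite -scalerA -Bd scalemxAr -mulmxDr Bt /e subrKC.
  have /eqP : (t / NY e - 1) *: e = 0 by rewrite scalerBl scale1r te subrr.
  rewrite scaler_eq0 (negbTE e_neq0) orbF subr_eq0 => /eqP teN.
  by rewrite -[t](divfK (lt0r_neq0 Ne_gt0)) teN mul1r.
have := sNX _ (w0S _ Yt Bt).
rewrite addrAC subrr add0r NX_homog gtr0_norm // tN lee_fin => sle.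
by rewrite ler_pdivrMr // mulrC.
Qed.

(** Here [I] stands for an inverse norm and [a] for a lower bound of it. If [I] is infinite, the
    quotient is 0, so [r] is nonpositive. *)
Lemma lee_mul_inve_sqr (r K a : R) (I : \bar R) :
  0 < K -> 0 < a -> (a%:E <= I)%E -> (r%:E <= K%:E / I ^+ 2)%E ->
  r * a ^+ 2 <= K.
Proof.
move=> K_gt0 a_gt0; case: I => [b| |//].
  rewrite lee_fin => ab; have b_gt0 := lt_le_trans a_gt0 ab.
  rewrite -EFin_expe inver sqrf_eq0 (gt_eqF b_gt0) -EFinM lee_fin.
  rewrite ler_pdivlMr ?exprn_gt0 // => rb.
  have [r_ge0|/ltW r_le0] := leP 0 r.
    apply: le_trans rb; rewrite ler_wpM2l //.
    by rewrite ler_sqr ?nnegrE // ltW.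
  apply: (@le_trans _ _ 0); last exact: ltW.
  by rewrite mulr_le0_ge0 // sqr_ge0.
move=> _; rewrite (_ : (+oo ^+ 2)%E = +oo%E :> \bar R) // invey mule0 lee_fin.
move=> r_le0; apply: (@le_trans _ _ 0); last exact: ltW.
by rewrite mulr_le0_ge0 // sqr_ge0.
Qed.

Lemma min_value_le (f : 'cV[R]_n -> \bar R) Y x :
  Y x -> (min_value f Y <= f x)%E.
Proof. by move=> Yx; apply: ereal_inf_lbound; exists x. Qed.

(** Each nonnegative real below [I] is an admissible growth constant. For infinite [I] the supremum
    cannot be a real [s], as [s + 1] would be admissible too; a negative [I] lies below the
    admissible constant 0. *)
Lemma le_mu_sharp (f : 'cV[R]_n -> \bar R) Y D (I : \bar R) :
  min_value f Y \is a fin_num ->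
  (forall r : R, 0 <= r -> (r%:E <= I)%E -> forall x, Y x ->
     ((r * D (bar f Y D x) x)%:E <= f x - min_value f Y)%E) ->
  (I <= mu_sharp f Y D)%E.
Proof.
move=> minfin growth.
have ge (r : R) : 0 <= r -> (r%:E <= I)%E -> (r%:E <= mu_sharp f Y D)%E.
  move=> r_ge0 rI; apply: ereal_sup_ubound; exists r => //.
  by split=> // x; exact: growth.
have ge0 : (0 <= mu_sharp f Y D)%E.
  apply: ereal_sup_ubound; exists 0 => //; split=> // x Yx.
  by rewrite mul0r suber_ge0 // min_value_le.
case: I ge {growth} => [r| |] ge; last exact: leNye.
  have [/ge|/ltW r_le0] := leP 0 r; first exact.
  by apply: le_trans ge0; rewrite lee_fin.
move: ge0 ge; case: (mu_sharp f Y D) => [s| |] //.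
rewrite lee_fin => s_ge0 /(_ (s + 1)).
rewrite leey lee_fin addr_ge0 // => /(_ isT isT).
by rewrite gerDl ler10.
Qed.

(** Common core of both cases, applied to [A] with [mu_g] and to [M] with 1. When [D xb x > 0], the
    inverse norm at [x] is at least [s / L], so any [r] below the infimum satisfies
    [r * s ^+ 2 <= K * L ^+ 2], which is the growth bound because [s ^+ 2 = 2 * D xb x]. *)
Lemma inf_inv_norm_le_mu_sharp (B : 'M[R]_(k, n)) (K : R)
    (f : 'cV[R]_n -> \bar R) (Y : set 'cV[R]_n) (D : 'cV[R]_n -> 'cV[R]_n -> R) :
  0 < K -> min_value f Y \is a fin_num -> minimizers f Y !=set0 ->
  distance_like Y D ->
  (forall x y, Y x -> Y y -> D y x <= 2^-1 * NX (y - x) ^+ 2) ->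
  (forall x, Y x -> closest D (minimizers f Y) x !=set0) ->
  (forall x y, Y x -> minimizers f Y y -> (B *m x = B *m y <-> minimizers f Y x)) ->
  (forall x y, Y x -> minimizers f Y y ->
     ((K / 2 * NY (B *m y - B *m x) ^+ 2)%:E <= f x - min_value f Y)%E) ->
  (ereal_inf [set K%:E / (inv_norm NX NY B C) ^+ 2
             | C in tangent_cones B Y (minimizers f Y)] <= mu_sharp f Y D)%E.
Proof.
set S := minimizers f Y.
move=> K_gt0 minfin [y0 Sy0] Ddist Dle barP SB growth.
have SY y : S y -> Y y by case.
apply: le_mu_sharp => // r r_ge0 rle x Yx.
have [Sbar barmin] : closest D S x (bar f Y D x) by exact: xgetPex (barP x Yx).
set xb := bar f Y D x in Sbar barmin *.
have [D_ge0 _] := Ddist _ _ Yx (SY _ Sbar).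
have [D0|D_neq0] := eqVneq (D xb x) 0.
  by rewrite D0 mulr0 suber_ge0 // min_value_le.
have D_gt0 : 0 < D xb x by rewrite lt_def D_neq0.
(* Otherwise [x] lies in [S], and the choice of [xb] gives [D xb x <= D x x = 0]. *)
have Bx : B *m x <> B *m y0.
  move=> /(SB _ _ Yx Sy0) Sx; have := barmin _ Sx.
  by have [_ ->] := Ddist _ _ Yx Yx; rewrite leNgt D_gt0.
apply: le_trans (growth _ _ Yx Sy0); rewrite lee_fin.
have NYgt0 : 0 < NY (B *m y0 - B *m x).
  rewrite lt_def NY_ge0 andbT; apply/eqP => /NY_eq0 /eqP.
  by rewrite subr_eq0 => /eqP /esym.
set L := NY _ in NYgt0 *.
(* This [s] bounds the distance to [S] from below, since [D xb x <= D y x <= NX (y - x) ^+ 2 / 2]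
   for [y] in [S]. *)
pose s := Num.sqrt (2 * D xb x).
have s_gt0 : 0 < s by rewrite sqrtr_gt0 mulr_gt0.
have ss : s ^+ 2 = 2 * D xb x by rewrite sqr_sqrtr // mulr_ge0.
have sle y : S y -> s <= NX (y - x).
  move=> Sy; have := le_trans (barmin _ Sy) (Dle _ _ Yx (SY _ Sy)).
  have NX_ge0 := is_norm_ge0 hNX (y - x).
  move=> h; rewrite -ler_sqr ?nnegrE ?(ltW s_gt0) // ss; lra.
have Ile : ((s / L)%:E <= inv_norm NX NY B (tangent_cone B Y S x))%E.
  apply: ge_inv_norm => //; first by exists y0.
    by move=> y Sy; exact/(SB _ _ (SY _ Sy) Sy0).
  by move=> y Yy /(SB _ _ Yy Sy0).
have := lee_mul_inve_sqr K_gt0 (divr_gt0 s_gt0 NYgt0) Ile.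
move=> /(_ r); rewrite expr_div_n ss mulrA ler_pdivrMr ?exprn_gt0 //.
have rle' : (r%:E <= K%:E / inv_norm NX NY B (tangent_cone B Y S x) ^+ 2)%E.
  apply: le_trans rle _; apply: ereal_inf_lbound.
  by exists (tangent_cone B Y S x) => //; exists x.
by move=> /(_ rle'); lra.
Qed.

End Growth.

(** * Polyhedra: segments and half-spaces *)

Section Polyhedron.
Variables (R : realType) (n : nat).

Lemma polyhedron_segment (Y : set 'cV[R]_n) x y (t : R) :
  polyhedron Y -> Y x -> Y y -> 0 <= t -> t <= 1 -> Y (y + t *: (x - y)).
Proof.
move=> [k [B [b ->]]] /= Yx Yy t_ge0 t_le1 i.
rewrite mulmxDr -scalemxAr mulmxBr !mxE.
have := Yx i; have := Yy i; rewrite !mxE.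
set bx := \sum_j _ * x j 0; set by_ := \sum_j _ * y j 0 => hy hx.
have : t * bx <= t * b i 0 by rewrite ler_wpM2l.
have : (1 - t) * by_ <= (1 - t) * b i 0 by rewrite ler_wpM2l // subr_ge0.
lra.
Qed.

Lemma polyhedron_halfspace (Y : set 'cV[R]_n) v (a : R) :
  polyhedron Y -> polyhedron (Y `&` [set x | dot v x <= a]).
Proof.
move=> [k [B [b ->]]].
exists (k + 1)%N, (col_mx B v^T), (col_mx b (const_mx a)).
apply/seteqP; split=> x /=.
  move=> [Yx vx] i; rewrite mul_col_mx; case: (split_ordP i) => j ->.
    by rewrite !col_mxEu.
  by rewrite !col_mxEd !ord1 [const_mx _ _ _]mxE.
move=> Hx; split=> [i|].
  by have := Hx (lshift 1 i); rewrite mul_col_mx !col_mxEu.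
by have := Hx (rshift k ord0); rewrite mul_col_mx !col_mxEd [const_mx _ _ _]mxE.
Qed.

End Polyhedron.

(** * Minimizers over a smaller set that still contains them all *)

Section Minimizers.
Variables (R : realType) (n : nat) (f : 'cV[R]_n -> \bar R).

Lemma minimizers_le X x y : X x -> minimizers f X y -> (f y <= f x)%E.
Proof. by move=> Xx [_ ->]; exact: min_value_le. Qed.

Lemma min_value_subset X Y :
  minimizers f X !=set0 -> Y `<=` X -> minimizers f X `<=` Y ->
  min_value f Y = min_value f X.
Proof.
move=> [y Sy] YX SY; apply/eqP; rewrite eq_le; apply/andP; split.
  by have [_ <-] := Sy; apply: min_value_le; exact: SY.
by apply: ereal_inf_le_tmp; exact: image_subset.
Qed.

Lemma minimizers_subset X Y :
  minimizers f X !=set0 -> Y `<=` X -> minimizers f X `<=` Y ->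
  minimizers f Y = minimizers f X.
Proof.
move=> S0 YX SY; rewrite /minimizers (min_value_subset S0 YX SY).
apply/seteqP; split=> x [Yx fx]; split=> //; first exact: YX.
by apply: SY; split.
Qed.

End Minimizers.

Theorem theorem4 (R : realType) (n m : nat)
  (Nn : 'cV[R]_n -> R) (Nm : 'cV[R]_m -> R)
  (hNn : is_norm Nn) (hNm : is_norm Nm)
  (A : 'M[R]_(m, n)) (c : 'cV[R]_n)
  (g : 'cV[R]_m -> \bar R) (mu_g : R)
  (g_ninfty : never_ninfty g) (g_convex : convex_ext g)
  (g_diff : differentiable_ext g) (g_strong : strongly_convex Nm mu_g g)
  (f : 'cV[R]_n -> \bar R)
  (f_def : forall x, f x = (g (A *m x) + (dot c x)%:E)%E)
  (X : set 'cV[R]_n) (X_poly : polyhedron X) (X_dom : X `<=` dom f)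
  (AX_many : exists x y, [/\ X x, X y & A *m x <> A *m y])
  (D : 'cV[R]_n -> 'cV[R]_n -> R)
  (D_dist : distance_like X D)
  (D_bound : forall x y, X x -> X y -> D x y <= 2^-1 * Nn (x - y) ^+ 2)
  (fstar_fin : min_value f X \is a fin_num)
  (Xstar_neq0 : minimizers f X !=set0)
  (bar_def : forall x, X x -> closest D (minimizers f X) x !=set0) :
  let Xstar := minimizers f X in
  exists v : 'cV[R]_n,
    [/\ forall y, Xstar y -> 2 *: grad (fine \o f) y = v,
        forall x y, X x -> Xstar y -> 0 <= dot v (x - y)
      & ((forall x y, X x -> Xstar y -> dot v (x - y) = 0) /\
         (ereal_inf [set mu_g%:E / (inv_norm Nn Nm A C) ^+ 2
                    | C in tangent_cones A X Xstar] <= mu_sharp f X D)%E)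
        \/
        ((exists x y, [/\ X x, Xstar y & 0 < dot v (x - y)]) /\
         forall delta : R, 0 < delta ->
           let Xdelta := [set x | X x /\
                            forall y, Xstar y -> dot v (x - y) <= delta] in
           let M : 'M[R]_(m + 1, n) :=
             col_mx (Num.sqrt mu_g *: A) ((Num.sqrt delta)^-1 *: v^T) in
           [/\ polyhedron Xdelta,
               Xstar `<=` Xdelta
             & (ereal_inf [set 1 / (inv_norm Nn (sqrt_sum_norm Nm) M C) ^+ 2
                          | C in tangent_cones M Xdelta Xstar]
                <= mu_sharp f Xdelta D)%E])].
Proof.
move=> Xstar.
have [_ Nm_homog Nm_eq0] := hNm.
have [mu_gt0 g_breg] := g_strong.

(* Optimality conditions and growth of [f] over [X] *)
have gfin x : X x -> g (A *m x) \is a fin_num.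
  move=> /X_dom; rewrite /dom /= f_def fin_numE; move: (g_ninfty (A *m x)).
  by case: (g (A *m x)).
have ffin x : X x -> f x \is a fin_num by move=> /gfin gx; rewrite f_def fin_numD gx.
have fineE x : X x -> fine (f x) = fine (g (A *m x)) + dot c x.
  by move=> /gfin gx; rewrite f_def fineD.
have gdom x : X x -> dom g (A *m x).
  by move=> /gfin; rewrite /dom /= ltey_eq => ->.
have gradE y : X y ->
    grad (fine \o f) y = A^T *m grad (fine \o g) (A *m y) + c.
  by move=> /gdom /g_diff [gnear gdiff]; exact: (grad_affine_comp f_def gnear gdiff).
(* The linear part [c] cancels between [f] and its gradient, leaving the Bregman distance of [g]. *)
have bregE x y : X x -> X y -> fine (f x) - fine (f y) =
    bregman g (A *m x) (A *m y) + dot (grad (fine \o f) y) (x - y).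
  move=> Xx Xy; rewrite gradE // dotDl -dot_mulmx mulmxBr !fineE // /bregman.
  by rewrite (dotBr _ _ c); ring.
have opt x y : X x -> Xstar y -> 0 <= dot (grad (fine \o f) y) (x - y).
  move=> Xx Sy; have [Xy _] := Sy; have [gnear gdiff] := g_diff _ (gdom _ Xy).
  have [der eq] := is_derive_affine_comp (x - y) f_def gnear gdiff.
  rewrite gradE // -eq; apply: derive_ge0_min der _ => t t_gt0 t_le1 /=.
  have Xt : X (y + t *: (x - y)) by apply: polyhedron_segment => //; exact: ltW.
  by rewrite fine_le ?ffin //; exact: minimizers_le Xt Sy.
have fS x y : Xstar x -> Xstar y -> f x = f y by move=> [_ ->] [_ ->].
(* With equal values of [f], the Bregman term and the nonnegative first-order term sum to 0, so
   strong convexity gives [A *m x - A *m y] norm 0. *)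
have AS x y : Xstar x -> Xstar y -> A *m x = A *m y.
  move=> Sx Sy; have [[Xx _] [Xy _]] := (Sx, Sy).
  have := g_breg _ _ (gdom _ Xy) (gdom _ Xx).
  have := bregE _ _ Xx Xy; rewrite (fS x y Sx Sy) subrr.
  have := opt _ _ Xx Sy => hopt hb hbr.
  apply/eqP; rewrite -subr_eq0; apply/eqP/Nm_eq0.
  apply/eqP; rewrite -sqrf_eq0 eq_le sqr_ge0 andbT.
  rewrite -(pmulr_rle0 _ (_ : 0 < mu_g / 2)); last by lra.
  lra.
have gradS x y : Xstar x -> Xstar y -> grad (fine \o f) x = grad (fine \o f) y.
  move=> Sx Sy; have [[Xx _] [Xy _]] := (Sx, Sy).
  by rewrite !gradE // (AS x y).
have [y0 Sy0] := Xstar_neq0.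
pose v := 2 *: grad (fine \o f) y0.
have vE y : Xstar y -> 2 *: grad (fine \o f) y = v.
  by move=> Sy; rewrite (gradS y y0).
have v_ge0 x y : X x -> Xstar y -> 0 <= dot v (x - y).
  by move=> Xx Sy; rewrite -(vE y Sy) dotZl mulr_ge0 ?opt.
(* The factor [2^-1] undoes the factor 2 in [v]. *)
have growth x y : X x -> Xstar y ->
    ((mu_g / 2 * Nm (A *m y - A *m x) ^+ 2 + 2^-1 * dot v (x - y))%:E
     <= f x - min_value f X)%E.
  move=> Xx Sy; have [Xy <-] := Sy.
  rewrite -(fineK (ffin _ Xx)) -(fineK (ffin _ Xy)) -EFinB lee_fin.
  rewrite bregE // -(vE y Sy) dotZl -opprB (is_normN hNm).
  by have := g_breg _ _ (gdom _ Xy) (gdom _ Xx); lra.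
(* Both terms of [bregE] vanish under these equalities. *)
have SE x y : X x -> Xstar y -> A *m x = A *m y -> dot v (x - y) = 0 -> Xstar x.
  move=> Xx Sy Axy; rewrite -(vE y Sy) dotZl => /eqP.
  rewrite mulf_eq0 pnatr_eq0 /= => /eqP vxy; have [Xy fy] := Sy.
  split=> //; rewrite -fy -(fineK (ffin _ Xx)) -(fineK (ffin _ Xy)); congr EFin.
  apply/eqP; rewrite -subr_eq0 bregE // vxy Axy /bregman dotBr !subrr.
  by rewrite addr0.
(* The inequality [v_ge0] holds in both orders of [x] and [y]. *)
have vS x y : Xstar x -> Xstar y -> dot v (x - y) = 0.
  move=> Sx Sy; have [[Xx _] [Xy _]] := (Sx, Sy).
  have := v_ge0 _ _ Xx Sy; have := v_ge0 _ _ Xy Sx.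
  by rewrite !dotBr; lra.
exists v; split=> //.
have [v0|] := pselect (forall x y, X x -> Xstar y -> dot v (x - y) = 0).

  (* Case 1: the first-order term vanishes on [X] *)
  left; split=> //.
  apply: inf_inv_norm_le_mu_sharp => //.
  - exact: is_norm_ge0.
  - by move=> x y Xx Xy; exact: D_bound.
  - move=> x y Xx Sy; split=> [Axy|Sx]; last exact: AS.
    exact: SE Xx Sy Axy (v0 x y Xx Sy).
  - move=> x y Xx Sy; apply: le_trans (growth x y Xx Sy).
    by rewrite v0 // mulr0 addr0.

(* Case 2: the first-order term is somewhere positive *)
move=> /existsNP [x1 /existsNP [y1 /not_implyP [Xx1 /not_implyP [Sy1 /eqP vn0]]]].
right; split.
  by exists x1, y1; split=> //; rewrite lt_def vn0 v_ge0.
move=> delta delta_gt0 Xdelta M.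
have SXd : Xstar `<=` Xdelta.
  by move=> x Sx; have [Xx _] := Sx; split=> // y Sy; rewrite vS // ltW.
have XdX : Xdelta `<=` X by move=> x [].
have dvE x y z : Xstar y -> Xstar z -> dot v (x - y) = dot v (x - z).
  by move=> Sy Sz; have := vS y z Sy Sz; rewrite !dotBr; lra.
have minE := min_value_subset Xstar_neq0 XdX SXd.
have argminE := minimizers_subset Xstar_neq0 XdX SXd.
split=> //.
  (* As [dot v] is constant on [Xstar], the constraints for all [y] collapse to the one for [y0]. *)
  rewrite (_ : Xdelta = X `&` [set x | dot v x <= delta + dot v y0]).
    exact: polyhedron_halfspace.
  apply/seteqP; split=> x [Xx].
    by move=> /(_ _ Sy0); rewrite dotBr /= => ?; split=> //=; lra.
  by move=> /= vx; split=> // y Sy; rewrite (dvE x y y0) // dotBr; lra.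
have s_mu : Num.sqrt mu_g != 0 by rewrite gt_eqF // sqrtr_gt0.
have s_delta : (Num.sqrt delta)^-1 != 0.
  by rewrite invr_eq0 gt_eqF // sqrtr_gt0.
have uM u : usubmx (M *m u) = Num.sqrt mu_g *: (A *m u).
  by rewrite mul_col_mx col_mxKu -scalemxAl.
have dM u : dsubmx (M *m u) 0 0 = (Num.sqrt delta)^-1 * dot v u.
  by rewrite mul_col_mx col_mxKd -scalemxAl mxE.
(* The constant is 1 because [mu_g] is already absorbed into [M]. *)
rewrite -[Xstar]argminE; apply: inf_inv_norm_le_mu_sharp => //.
- exact: sqrt_sum_normZ.
- by move=> z; exact: sqrtr_ge0.
- exact: sqrt_sum_norm_eq0.
- by rewrite minE.
- by rewrite argminE.
- by move=> x y /XdX Xx /XdX Xy; exact: D_dist.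
- by move=> x y /XdX Xx /XdX Xy; exact: D_bound.
- by move=> x /XdX Xx; rewrite argminE; exact: bar_def.
(* Both scalings in [M] are nonzero, so a fiber of [M] records exactly the two equalities required
   by [SE]. *)
- rewrite argminE => x y Xdx Sy; have Xx := XdX _ Xdx; split=> [Mxy|Sx].
    apply: (SE x y) => //.
      by apply: (scalerI s_mu); rewrite -!uM Mxy.
    apply: (mulfI s_delta); rewrite -dM mulmxBr Mxy subrr mulr0.
    by rewrite linear0 mxE.
  rewrite -[LHS]vsubmxK -[RHS]vsubmxK !uM (AS x y) //; congr col_mx.
  apply/matrixP => i j; rewrite !ord1 !dM; congr (_ * _).
  by apply/eqP; rewrite -subr_eq0 -dotBr vS.
rewrite argminE minE => x y Xdx Sy; have Xx := XdX _ Xdx.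
apply: le_trans (growth x y Xx Sy); rewrite lee_fin -mulmxBr.
rewrite sqrt_sum_norm_sqr uM dM Nm_homog ger0_norm ?sqrtr_ge0 // !exprMn.
rewrite exprVn !sqr_sqrtr ?(ltW mu_gt0) ?(ltW delta_gt0) // mulmxBr.
(* 0 <= <v, x - y> <= delta gives <v, x - y> ^ 2 / delta <= <v, x - y> *)
have [_ /(_ _ Sy) vle] := Xdx; have vge := v_ge0 _ _ Xx Sy.
have -> : dot v (y - x) = - dot v (x - y) by rewrite !dotBr opprB.
have : delta^-1 * (- dot v (x - y)) ^+ 2 <= dot v (x - y).
  by rewrite sqrrN mulrC ler_pdivrMr // expr2 ler_wpM2l.
lra.
Qed.
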